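(* Let $p_k=2^{-k-2}$ and $x_k=2^{2k^2}$ for $k=0,1,2,\dots$ There is a doubly infinite sequence $h(n)$, $n\in\mathbb{Z}$, which satisfies $$h(n)=\sum_{k=0}^\infty p_k\bigl(h(n+x_k)+h(n-x_k)\bigr)$$ for every $n\in\mathbb{Z}$, and such that for every $\varepsilon>0$, $$\lim_{|n|\to\infty}\frac{h(n)}{|n|^\varepsilon}=0,$$ but $h(n)$ is not a polynomial sequence. Furthermore, for every $\varepsilon>0$, we have $$\lim_{|n|\to\infty}\frac1{|n|^\varepsilon}\sum_{k=0}^\infty p_k\bigl(|h(n+x_k)|+|h(n-x_k)|\bigr)=0.$$
   Context: A polynomial sequence is a sequence of the form $n\mapsto P(n)$, $n \in \mathbb{Z}$, for a polynomial $P$. *)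

(* Defs.v *)
From HB Require Import structures.
From mathcomp Require Import all_boot all_order all_algebra.
From mathcomp Require Import all_classical all_reals all_analysis.

Set Implicit Arguments.
Unset Strict Implicit.
Unset Printing Implicit Defensive.

Import Order.TTheory GRing.Theory Num.Theory.
Import numFieldNormedType.Exports.

Local Open Scope classical_set_scope.
Local Open Scope ring_scope.

(* The filter of the limits taken as |n| -> oo, for n ranging over the
   integers (so n -> +oo and n -> -oo simultaneously). *)
Definition int_infty : set_system int :=
  [set A | exists N : nat, forall n : int, (N <= `|n|)%N -> A n].

Global Instance int_infty_proper : ProperFilter int_infty.
Proof.
apply: Build_ProperFilter_ex.
  by move=> A [N NA]; exists N%:Z; apply: NA.
split.
- by exists 0%N.
- move=> A B [N NA] [M MB]; exists (maxn N M) => n.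
  by rewrite geq_max => /andP[Nn Mn]; split; [exact: NA|exact: MB].
- by move=> A B AB [N NA]; exists N => n /NA /AB.
Qed.

Definition polynomial_sequence (R : realType) (h : int -> R) : Prop :=
  exists P : {poly R}, forall n : int, h n = P.[n%:~R].

Definition jump_prob (R : realType) (k : nat) : R := 2 ^- (k + 2)%N.

Definition jump_size (k : nat) : int := 2 ^+ (2 * k ^ 2)%N.

(* Main.v *)
Require Import Defs.
From HB Require Import structures.
From mathcomp Require Import all_boot all_order all_algebra.
From mathcomp Require Import all_classical all_reals all_analysis.
From mathcomp Require Import zify ring lra.

(** The equation at n is made solvable by reserving one private site for it.
    Call the level of n the index l at which the jump x_l first exceeds 2|n|,
    and let n own the site n + x_k with k = 2l + 1, its landing.  The jumps
    grow so fast that landings are extremely sparse: a landing n + x_k is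
    positive and of size about x_k, so it reveals k and hence its owner n.

    Let h(0) = 1, let h vanish at every other site that is not a landing, and
    let h(n + x_k) be the value that makes the equation at n true.  This is a
    legitimate recursion because the equation at n involves only finitely many
    nonzero values: for j >= l the site n - x_j is negative, hence no landing,
    while n + x_j is a landing only if j = k [far_landing]; and for j < l the
    sites n + x_j and n - x_j have size below x_l, hence smaller than n + x_k
    [near_site, jump_level_lt_landing].  So every series in the theorem is
    eventually constant.  As h(0) = 1 and h vanishes on the negative integers,
    h is not polynomial.

    For the growth, solving for h(n + x_k) costs a factor 2 / p_k = 2^(k+3)
    over the values at sites of size below x_l.  Since l is about k / 2, the
    exponents picked up along the recursion add up to k + k/2 + k/4 + ..., that
    is, to O(k): |h| <= 16^l below x_l = 2^(2l^2) [sparse_harmonic_le].  In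
    terms of n this is exp(O(sqrt(log |n|))), which is below every power of
    |n| [subpolynomial_cvg0].  The mean of |h| over the jumps from n obeys the
    same bound, because the equation at n controls the one far term. *)

Set Implicit Arguments.
Unset Strict Implicit.
Unset Printing Implicit Defensive.

Import Order.TTheory GRing.Theory Num.Theory.
Import numFieldNormedType.Exports.

Local Open Scope classical_set_scope.
Local Open Scope ring_scope.

(** * Jumps, levels and landings *)

Definition jump (k : nat) : nat := (2 ^ (2 * k ^ 2))%N.

Lemma jump_sizeE k : jump_size k = (jump k)%:Z.
Proof. by rewrite /jump_size /jump -natz natrX. Qed.

Lemma jump_gt0 k : (0 < jump k)%N.
Proof. by rewrite expn_gt0. Qed.

Lemma jump_lt i j : (i < j)%N -> (4 * jump i <= jump j)%N.
Proof.
move=> ij; rewrite /jump -(expnD 2 2) leq_exp2l //; nia.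
Qed.

Lemma leq_jump i j : (i <= j)%N -> (jump i <= jump j)%N.
Proof. by move=> ij; rewrite leq_exp2l // leq_mul2l leq_exp2r. Qed.

Lemma level_subproof (n : int) : exists l, (2 * `|n| < jump l)%N.
Proof.
exists (2 * `|n|)%N; rewrite (leq_trans (ltn_expl _ (ltnSn 1))) //.
by rewrite leq_exp2l //; nia.
Qed.

Definition level (n : int) : nat := ex_minn (level_subproof n).

Lemma lt_jump_level n : (2 * `|n| < jump (level n))%N.
Proof. by rewrite /level; case: ex_minnP. Qed.

Lemma level_min n l : (2 * `|n| < jump l)%N -> (level n <= l)%N.
Proof. by rewrite /level; case: ex_minnP => m _ /(_ l). Qed.

(** Any index above the level would make the recursion well founded.  Doubling
    the level makes the exponents k of the factors 1 / p_k met along the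
    recursion decrease geometrically; a stride of level plus one would let them
    add up to order k^2, which is polynomial growth in n. *)
Definition stride (n : int) : nat := (2 * level n).+1.

Definition landing (n : int) : int := n + jump_size (stride n).

Lemma lt_level_stride n : (level n < stride n)%N.
Proof. by rewrite /stride; lia. Qed.

Lemma landing_gt0 n : 0 < landing n.
Proof.
have := lt_jump_level n; have := jump_lt (lt_level_stride n).
rewrite /landing jump_sizeE; lia.
Qed.

Lemma landing_bounds n :
  (7 * jump (stride n) < 8 * `|landing n| < 9 * jump (stride n))%N.
Proof.
have := lt_jump_level n; have := jump_lt (lt_level_stride n).
rewrite /landing jump_sizeE; lia.
Qed.

(** Both n + x_j and landing m are within a factor less than 2 of a jump, of
    indices j and [stride m], and distinct jumps differ by a factor at least 4;
    so the two indices agree, and then so do the base points. *)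
Lemma far_landing n m j : (level n <= j)%N ->
  n + jump_size j = landing m -> m = n /\ j = stride n.
Proof.
move=> lj E; have := landing_bounds m.
have := lt_jump_level n; have := leq_jump lj.
have jE : j = stride m -> m = n /\ j = stride n.
  by move=> jm; move: E; rewrite /landing jm => /addIr ->.
move: E; rewrite jump_sizeE.
have [/jump_lt|/jump_lt|/jE//] := ltngtP j (stride m); lia.
Qed.

Lemma landing_inj : injective landing.
Proof.
by move=> n m /(far_landing (ltnW (lt_level_stride n))) [].
Qed.

Lemma near_site n j : (j < level n)%N ->
  (`|(n + jump_size j)%R| < jump (level n))%N /\
  (`|(n - jump_size j)%R| < jump (level n))%N.
Proof.
by move=> /jump_lt; have := lt_jump_level n; rewrite jump_sizeE; lia.
Qed.

Lemma jump_level_lt_landing n : (jump (level n) < `|landing n|)%N.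
Proof.
have := landing_bounds n; have := jump_lt (lt_level_stride n).
have := jump_gt0 (level n); lia.
Qed.

(** * The recursive construction *)

Section Construction.
Variable R : realType.
Implicit Types f : int -> R.
Local Notation p := (@jump_prob R).
Local Notation x := jump_size.

Lemma jump_prob_gt0 k : 0 < p k.
Proof. by rewrite invr_gt0 exprn_gt0. Qed.

Lemma jump_prob_ge0 k : 0 <= p k.
Proof. exact: ltW (jump_prob_gt0 k). Qed.

(** The part of the average at n whose sites precede [landing n] in size. *)
Definition near_sum f n : R :=
  \sum_(j < level n) p j * (f (n + x j) + f (n - x j)).

(** The value at [landing n] that makes the equation at n hold when f vanishes
    at all the other sites at distance x_j from n with j >= [level n]. *)
Definition solve f n : R := (p (stride n))^-1 * (f n - near_sum f n).

Lemma eq_solve f g n :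
    (forall m, (`|m| < jump (level n))%N -> f m = g m) -> solve f n = solve g n.
Proof.
move=> fg; rewrite /solve /near_sum fg; last by have := lt_jump_level n; lia.
congr (_ * (_ - _)); apply: eq_bigr => j _.
by have [? ?] := near_site (ltn_ord j); rewrite !fg.
Qed.

(** The depth d replaces well-founded recursion on |N|; it is immaterial as
    soon as it is at least |N| [approx_stable]. *)
Fixpoint approx d N : R :=
  if N == 0 then 1 else
  if d is d'.+1 then
    if pselect (exists n, landing n = N) is left e
    then solve (approx d') (sval (cid e)) else 0
  else 0.

Lemma approx_stable d e N :
  (`|N| <= d)%N -> (`|N| <= e)%N -> approx d N = approx e N.
Proof.
elim: d e N => [|d IH] [|e] N Nd Ne //=.
- by have -> : N = 0 by lia.
- by have -> : N = 0 by lia.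
case: eqP => // _; case: pselect => // ex; case: (cid ex) => n /= nN.
have := jump_level_lt_landing n; rewrite nN => lN.
by apply: eq_solve => m ml; apply: IH; lia.
Qed.

Definition sparse_harmonic N : R := approx `|N| N.
Local Notation h := sparse_harmonic.

Lemma sparse_harmonic0 : h 0 = 1. Proof. by []. Qed.

Lemma sparse_harmonic_landing n : h (landing n) = solve h n.
Proof.
have lN := jump_level_lt_landing n; have := landing_gt0 n.
rewrite /sparse_harmonic; case: `|_|%N lN => [|d] lN N0; first by lia.
rewrite /= gt_eqF //; case: pselect => [ex|noex]; last by case: noex; exists n.
case: (cid ex) => m /= mn; rewrite (landing_inj mn); apply: eq_solve => k kl.
by apply: approx_stable => //; lia.
Qed.

Lemma sparse_harmonic_out N :
  N != 0 -> (forall n, landing n <> N) -> h N = 0.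
Proof.
rewrite /sparse_harmonic => N0 Nl; case: `|N|%N => [|d] /=.
  by rewrite (negbTE N0).
by rewrite (negbTE N0); case: pselect => // ex; case: ex Nl => n nN /(_ n).
Qed.

Lemma sparse_harmonic_lt0 N : N < 0 -> h N = 0.
Proof.
move=> N0; apply: sparse_harmonic_out; first by lia.
by move=> n nN; have := landing_gt0 n; lia.
Qed.

(** The next two lemmas say that the average at n sees, beyond the sites of
    [near_sum], only [landing n]. *)
Lemma sparse_harmonic_far_left n j : (level n <= j)%N -> h (n - x j) = 0.
Proof.
move=> /leq_jump lj; apply: sparse_harmonic_lt0; rewrite jump_sizeE.
by have := lt_jump_level n; lia.
Qed.

Lemma sparse_harmonic_far_right n j :
  (level n <= j)%N -> j != stride n -> h (n + x j) = 0.
Proof.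
move=> lj js; apply: sparse_harmonic_out => [|m E].
  have := lt_jump_level n; have := leq_jump lj; rewrite jump_sizeE; lia.
by have [_ /eqP] := far_landing lj (esym E); apply/negP.
Qed.

(** * The mean value property *)

Lemma series_lacunary (u : R^nat) l s : (l <= s)%N ->
    (forall k, (l <= k)%N -> k != s -> u k = 0) ->
  series u @ \oo --> \sum_(j < l) u j + u s.
Proof.
move=> ls u0; apply: cvg_near_cst; exists s.+1 => // K /= sK.
rewrite /series /= (@big_cat_nat _ _ _ l) //=; last by lia.
rewrite big_mkord; congr (_ + _).
rewrite (bigD1_seq s) /= ?iota_uniq ?mem_index_iota ?ls //.
rewrite big_nat_cond big1 ?addr0 // => k /andP[/andP[lk _]].
exact: u0.
Qed.

Lemma sparse_harmonic_mean n :
  series (fun k => p k * (h (n + x k) + h (n - x k))) @ \oo --> h n.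
Proof.
have ls := ltnW (lt_level_stride n).
have -> : h n = near_sum h n +
    p (stride n) * (h (n + x (stride n)) + h (n - x (stride n))).
  rewrite (sparse_harmonic_far_left ls) addr0 -/(landing n).
  rewrite sparse_harmonic_landing /solve mulVKf ?gt_eqF ?jump_prob_gt0 //.
  by rewrite addrC subrK.
apply: series_lacunary => // k lk ks.
by rewrite sparse_harmonic_far_left // sparse_harmonic_far_right ?addr0 ?mulr0.
Qed.

(** * Growth *)

Lemma sum_jump_prob l : \sum_(j < l) p j * 2 <= 1.
Proof.
suff -> : \sum_(j < l) p j * 2 = 1 - 2 ^- l.
  by rewrite gerBl invr_ge0 exprn_ge0.
elim: l => [|l IH]; first by rewrite big_ord0 expr0 invr1 subrr.
rewrite big_ord_recr /= IH /jump_prob addn2 !exprS; field.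
by rewrite expf_neq0.
Qed.

Lemma near_sum_norm_le f n (C : R) :
    (forall m, (`|m| < jump (level n))%N -> `|f m| <= C) ->
  near_sum (fun m => `|f m|) n <= C.
Proof.
move=> fC; have C0 : 0 <= C.
  by rewrite (le_trans _ (fC n _)) //; have := lt_jump_level n; lia.
apply: le_trans (_ : (\sum_(j < level n) p j * 2) * C <= C); last first.
  by rewrite ler_piMl // sum_jump_prob.
rewrite mulr_suml; apply: ler_sum => j _; rewrite -mulrA.
rewrite ler_wpM2l ?jump_prob_ge0 // mulr_natl mulr2n.
by have [? ?] := near_site (ltn_ord j); apply: lerD; apply: fC.
Qed.

(** The total mass of the jumps is 1, so f n and [near_sum f n] are each at
    most C in absolute value. *)
Lemma solve_norm_le f n (C : R) :
    (forall m, (`|m| < jump (level n))%N -> `|f m| <= C) ->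
  p (stride n) * `|solve f n| <= C *+ 2.
Proof.
move=> fC; have p0 := jump_prob_gt0 (stride n).
rewrite -(gtr0_norm p0) -normrM /solve mulVKf ?gt_eqF // mulr2n.
apply: le_trans (ler_normB _ _) (lerD _ _).
  by rewrite fC //; have := lt_jump_level n; lia.
apply: le_trans (near_sum_norm_le fC).
rewrite (le_trans (ler_norm_sum _ _ _)) //; apply: ler_sum => j _.
rewrite normrM (gtr0_norm (jump_prob_gt0 j)).
by rewrite ler_wpM2l ?jump_prob_ge0 // ler_normD.
Qed.

(** A landing below x_l has stride at most l, and its value is at most
    2^(k+3) 16^i, where k = 2i + 1 is its stride and i the level of its owner.
    The base 16 makes the induction close exactly: k + 3 + 4i = 6i + 4, which
    is at most 4k = 8i + 4. *)
Lemma sparse_harmonic_le l N : (`|N| < jump l)%N -> `|h N| <= 16 ^+ l.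
Proof.
elim/ltn_ind: l N => l IH N Nl.
have [->|N0] := eqVneq N 0.
  by rewrite sparse_harmonic0 normr1 exprn_ege1 // ler1n.
have [[n nN]|noN] := pselect (exists n, landing n = N); last first.
  rewrite sparse_harmonic_out ?normr0 ?exprn_ge0 // => n nN.
  by apply: noN; exists n.
have sl : (stride n <= l)%N.
  rewrite leqNgt; apply/negP => /jump_lt.
  by have := landing_bounds n; rewrite nN; lia.
have := @solve_norm_le h n (16 ^+ level n).
rewrite -sparse_harmonic_landing nN => /(_ (IH _ _)).
have ll : (level n < l)%N := leq_trans (lt_level_stride n) sl.
move=> /(_ ll) hN; apply: le_trans (_ : 16 ^+ stride n <= _); last first.
  by rewrite ler_weXn2l // ler1n.
move: hN; rewrite /jump_prob ler_pdivrMl ?exprn_gt0 // => /le_trans; apply.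
rewrite -(mulr_natl (16 ^+ _)) (_ : 16 = 2 ^+ 4 :> R); last by ring.
rewrite -!exprM mulrA -exprSr -exprD ler_weXn2l ?ler1n //.
rewrite /stride; lia.
Qed.

Definition abs_term n k : R := p k * (`|h (n + x k)| + `|h (n - x k)|).

(** The sum of the series of the [abs_term n]. *)
Definition abs_mean n : R :=
  near_sum (fun m => `|h m|) n + p (stride n) * `|h (landing n)|.

Lemma abs_mean_cvg n : series (abs_term n) @ \oo --> abs_mean n.
Proof.
have ls := ltnW (lt_level_stride n).
have -> : abs_mean n = \sum_(j < level n) abs_term n j + abs_term n (stride n).
  by rewrite {2}/abs_term sparse_harmonic_far_left // normr0 addr0.
apply: series_lacunary => // k lk ks; rewrite /abs_term.
by rewrite sparse_harmonic_far_left // sparse_harmonic_far_right // normr0 addr0 mulr0.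
Qed.

Lemma abs_mean_le n : `|abs_mean n| <= 3 * 16 ^+ level n.
Proof.
have hl m : (`|m| < jump (level n))%N -> `|h m| <= 16 ^+ level n.
  exact: sparse_harmonic_le.
rewrite ger0_norm; last first.
  by rewrite addr_ge0 ?sumr_ge0 // => [j _|]; rewrite mulr_ge0 ?addr_ge0 ?jump_prob_ge0.
have := lerD (near_sum_norm_le hl) (solve_norm_le hl).
by rewrite -sparse_harmonic_landing => /le_trans; apply; lra.
Qed.

(** By minimality of the level l, 2|n| is at least x_(l-1) = 2^(2(l-1)^2),
    whose exponent exceeds the linear 4lq + 1 once l > 2q + 4. *)
Lemma level_pow_le q n :
  (jump (2 * q + 4) <= 2 * `|n|)%N -> (16 ^ (level n * q) <= `|n|)%N.
Proof.
move=> qn; have ql : (2 * q + 4 < level n)%N.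
  rewrite ltnNge; apply/negP => /leq_jump.
  by have := lt_jump_level n; lia.
have ln : (jump (level n).-1 <= 2 * `|n|)%N.
  by rewrite leqNgt; apply/negP => /level_min; lia.
rewrite -(@leq_pmul2l 2) // (leq_trans _ ln) // (_ : 16%N = (2 ^ 4)%N) //.
rewrite -expnM -expnS /jump leq_exp2l //; nia.
Qed.

Lemma level_pow_le_powR q eps n : 1 <= eps * q%:R ->
    (jump (4 * q + 4) <= 2 * `|n|)%N ->
  ((16 ^+ level n) ^+ 2 : R) <= `|n%:~R| `^ eps.
Proof.
move=> eq1 qn; have q0 : (0 < q)%N.
  by case: q eq1 {qn} => //; rewrite mulr0 ler10.
have eps0 : 0 <= eps.
  by rewrite -(@pmulr_lge0 _ q%:R) ?ltr0n // (le_trans ler01).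
have := @level_pow_le (2 * q) n; rewrite mulnA => /(_ qn) nq.
set A : R := (16 ^+ level n) ^+ 2.
have A1 : 1 <= A by rewrite !exprn_ege1 // ler1n.
have Aq : A ^+ q <= `|n%:~R|.
  have -> : A ^+ q = (16 ^ (level n * (2 * q)))%:R.
    by rewrite natrX mulnA !exprM.
  by rewrite -intr_norm -abszE -pmulrn ler_nat.
apply: le_trans (_ : (A ^+ q) `^ eps <= _); last first.
  by rewrite ge0_ler_powR // nnegrE exprn_ge0 // (le_trans ler01).
have A0 : 0 <= A := le_trans ler01 A1.
rewrite -powR_mulrn // -powRrM -{1}[A]powRr1 //.
by rewrite ler_powR // mulrC.
Qed.

(** The square of 16^(level n) is already below |n|^eps, so the quotient is at
    most C / 16^(level n), which tends to 0 because levels tend to infinity. *)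
Lemma subpolynomial_cvg0 f (C eps : R) : 0 < eps ->
    (forall n, `|f n| <= C * 16 ^+ level n) ->
  (fun n : int => f n / `|n%:~R| `^ eps) @ int_infty --> (0 : R).
Proof.
move=> eps0 fC; apply/cvgr0Pnorm_lt => e e0.
pose q := Num.bound eps^-1; pose L := Num.bound (C / e).
have qE : 1 <= eps * q%:R.
  rewrite -ler_pdivrMl // mulr1 ltW // archi_boundP // invr_ge0 ltW //.
have C0 : 0 <= C.
  rewrite -(@pmulr_lge0 _ (16 ^+ level 0)) ?exprn_gt0 //.
  exact: le_trans (fC 0).
(* The summand L forces the level above C / e. *)
exists (jump (4 * q + 4 + L)) => n nN.
have Aeps : ((16 ^+ level n) ^+ 2 : R) <= `|n%:~R| `^ eps.
  apply: level_pow_le_powR qE _.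
  by have := @leq_jump (4 * q + 4) (4 * q + 4 + L); lia.
have Ln : (L < level n)%N.
  rewrite ltnNge; apply/negP => /leq_jump.
  have := lt_jump_level n; have := @leq_jump L (4 * q + 4 + L); lia.
have A0 : 0 < 16 ^+ level n :> R by rewrite exprn_gt0.
have P0 : 0 < `|n%:~R| `^ eps :> R.
  by rewrite (lt_le_trans _ Aeps) // exprn_gt0.
rewrite normrM normfV (gtr0_norm P0) ltr_pdivrMr //.
apply: le_lt_trans (fC n) _.
apply: lt_le_trans (_ : e * (16 ^+ level n) ^+ 2 <= _); last first.
  by rewrite ler_pM2l.
rewrite expr2 mulrA ltr_pM2r // -ltr_pdivrMl // mulrC.
have CL : C / e < L%:R by rewrite archi_boundP // divr_ge0 // ltW.
apply: lt_trans CL _; rewrite -natrX ltr_nat.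
by rewrite (ltn_trans Ln) // ltn_expl.
Qed.

Lemma sparse_harmonic_nonpoly : ~ polynomial_sequence h.
Proof.
case=> P hP; have P0 : P = 0.
  apply: (@roots_geq_poly_eq0 _ _
    [seq (- (i.+1)%:Z)%:~R | i <- iota 0 (size P).+1]).
  - apply/allP => _ /mapP[i _ ->]; apply/rootP; rewrite -hP.
    by apply: sparse_harmonic_lt0; lia.
  - by rewrite map_inj_uniq ?iota_uniq // => i j /intr_inj; lia.
  - by rewrite size_map size_iota.
have := sparse_harmonic0; rewrite hP P0 horner0 => /eqP.
by rewrite eq_sym oner_eq0.
Qed.

End Construction.

Theorem theorem4p2 (R : realType) :
  let p : nat -> R := @jump_prob R in
  let x : nat -> int := jump_size in
  exists h : int -> R,
    [/\ forall n : int,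
          series (fun k : nat => p k * (h (n + x k) + h (n - x k))) @ \oo --> h n,
        forall eps : R, 0 < eps ->
          (fun n : int => h n / `|n%:~R| `^ eps) @ int_infty --> (0 : R),
        ~ polynomial_sequence h,
        forall n : int,
          cvgn (series (fun k : nat => p k * (`|h (n + x k)| + `|h (n - x k)|)))
      & forall eps : R, 0 < eps ->
          (fun n : int => (`|n%:~R| `^ eps)^-1 *
             limn (series (fun k : nat =>
               p k * (`|h (n + x k)| + `|h (n - x k)|)))) @ int_infty --> (0 : R)].
Proof.
move=> p x; exists (@sparse_harmonic R); split.
- exact: sparse_harmonic_mean.
- move=> eps eps0; apply: (@subpolynomial_cvg0 _ _ 1) => // n.
  by rewrite mul1r sparse_harmonic_le //; have := lt_jump_level n; lia.
- exact: sparse_harmonic_nonpoly.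
- by move=> n; apply/cvg_ex; exists (abs_mean R n); apply: abs_mean_cvg.
- move=> eps eps0; under eq_fun => n.
    rewrite (cvg_lim _ (@abs_mean_cvg R n)) // mulrC.
    over.
  exact: subpolynomial_cvg0 eps0 (@abs_mean_le R).
Qed.
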